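(* Fix an integer $s\geqslant 2$. For every integer $n\geqslant 2$ let $\overline X_{n,s}$ be the fraction of the $n$ fluids that flow from the centre to the boundary, for a uniformly random coloring in $\Omega_{n,s}$. Let $p_s$ be the flowing probability of a single fluid. Then, as $n\to\infty$, the distribution function of the random variable \[\frac{\sqrt{n}\,(\overline X_{n,s}-p_s)}{\sqrt{p_s(1-p_s)}}\] converges uniformly on $\mathbb R$ to the standard normal distribution function. All these objects are defined in the context.
   Context: Consider the tiling of the plane by regular hexagons of side $1$, called cells. For an integer $s\geqslant2$, fix a cell $O$. Let $M_s$ be the set of all cells lying inside the regular hexagon that is centred at the centre of $O$, has sides of length $s\sqrt3$, and has its sides perpendicular to sides of the cells. The set $M_s$ has $m+1=1+3s(s-1)$ cells. Number the cells other than $O$ as $v_1,\dots,v_m$. Two cells are neighbours if they share a side. A cell of $M_s$ is a boundary cell if it has fewer than six neighbours in $M_s$. For an integer $n\geqslant2$, let $\Omega_{n,s}$ be the set of $n$-tuples $f=(f_1,\dots,f_n)$ of functions $f_i:\{v_1,\dots,v_m\}\to\{0,1\}$ such that $f_1+\dots+f_n\equiv1\pmod 2$ at every cell. These are colorings in $2^{n-1}$ colors. Equip $\Omega_{n,s}$ with the uniform probability measure $P(A)=|A|\,2^{-(n-1)m}$. A path from the centre to the boundary is a sequence of pairwise distinct cells $v_{j_1},\dots,v_{j_t}$ with the following properties: - $v_{j_1}$ is a neighbour of $O$; - $v_{j_l}$ and $v_{j_{l+1}}$ are neighbours for each $l$; - $v_{j_t}$ is a boundary cell. The $i$-th fluid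 flows from the centre to the boundary for $f$ if there is such a path with $f_i(v_{j_l})=1$ for all $l$. Let $A_{n,s,i}$ be this event. Let $X_{n,s,i}$ be its indicator, and set $\overline X_{n,s}=\frac1n\sum_{i=1}^nX_{n,s,i}$. The probability $P(A_{n,s,i})$ does not depend on $n$ or $i$; denote it by $p_s$ (for instance $p_s=P(A_{2,s,1})$). *)

(* Defs.v *)
From HB Require Import structures.
From mathcomp Require Import all_boot all_order all_algebra.
From mathcomp Require Import all_classical all_reals all_analysis.
Set Implicit Arguments. Unset Strict Implicit. Unset Printing Implicit Defensive.
Import Order.TTheory GRing.Theory Num.Theory.
Local Open Scope ring_scope.

(* Hexagonal cells are indexed by axial coordinates (a, b) in Z^2, with the six
   neighbours of (a,b) being (a±1,b), (a,b±1), (a+1,b-1), (a-1,b+1).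
   The cell O is (0,0). *)
Definition hex_adj (a1 b1 a2 b2 : int) : bool :=
  let da := a2 - a1 in let db := b2 - b1 in
  [|| (da == 1) && (db == 0), (da == -1) && (db == 0),
      (da == 0) && (db == 1), (da == 0) && (db == -1),
      (da == 1) && (db == -1) | (da == -1) && (db == 1)].

(* Hexagonal (graph) distance of the cell (a,b) from O, doubled. *)
Definition hex_dist2 (a b : int) : int := `|a| + `|b| + `|a + b|.

(* Grid box containing M_s : coordinates in 'I_(2s-1), shifted by s-1. *)
Definition coord (s : nat) (k : 'I_(s.*2.-1)) : int := (k : nat)%:Z - (s.-1)%:Z.
Arguments coord : clear implicits.

(* M_s: the cells at hexagonal distance <= s-1 from O (exactly the cells lying
   inside the regular hexagon of side s*sqrt 3 centred at O with sides
   perpendicular to the cell sides; there are 1+3s(s-1) of them). *)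
Definition inM (s : nat) (c : 'I_(s.*2.-1) * 'I_(s.*2.-1)) : bool :=
  hex_dist2 (coord s c.1) (coord s c.2) <= (s.-1)%:Z *+ 2.
Arguments inM : clear implicits.

Definition Cell (s : nat) := {c : 'I_(s.*2.-1) * 'I_(s.*2.-1) | inM s c}.

Definition cq (s : nat) (c : Cell s) : int := coord s (val c).1.
Definition cr (s : nat) (c : Cell s) : int := coord s (val c).2.

Definition is_O (s : nat) (c : Cell s) : bool := (cq c == 0) && (cr c == 0).

Definition V (s : nat) := {c : Cell s | ~~ is_O c}.

Definition cadj (s : nat) (c d : Cell s) : bool := hex_adj (cq c) (cr c) (cq d) (cr d).
Definition vadj (s : nat) (v w : V s) : bool := cadj (val v) (val w).

Definition boundary (s : nat) (c : Cell s) : bool := (#|[set d : Cell s | cadj c d]| < 6)%N.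

Definition Omega (n s : nat) : {set {ffun 'I_n -> {ffun V s -> bool}}} :=
  [set f : {ffun 'I_n -> {ffun V s -> bool}} | [forall v : V s, odd (\sum_(i < n) (f i v : nat))]].

Definition flows (n s : nat) (f : {ffun 'I_n -> {ffun V s -> bool}}) (i : 'I_n) : Prop :=
  exists (x : V s) (p : seq (V s)),
    [&& [exists o : Cell s, is_O o && cadj o (val x)],
        path (@vadj s) x p, uniq (x :: p),
        boundary (val (last x p)) & all (fun v => f i v) (x :: p)].

(* Uniform probability on Omega_{n,s}: P(A) = |A| 2^{-(n-1)m}, m = #|[set: V s]|. *)
Definition Prob {R : realType} (n s : nat) (A : {set {ffun 'I_n -> {ffun V s -> bool}}}) : R :=
  #|A|%:R / 2%:R ^+ ((n.-1) * #|[set: V s]|).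

Definition event_A (n s : nat) (i : 'I_n) : {set {ffun 'I_n -> {ffun V s -> bool}}} :=
  [set f in Omega n s | `[< flows f i >]].

Definition p_s {R : realType} (s : nat) : R := Prob (@event_A 2 s (@Ordinal 2 0 isT)).

Definition X_ind {R : realType} (n s : nat) (i : 'I_n) (f : {ffun 'I_n -> {ffun V s -> bool}}) : R :=
  if `[< flows f i >] then 1 else 0.

Definition Xbar {R : realType} (n s : nat) (f : {ffun 'I_n -> {ffun V s -> bool}}) : R :=
  n%:R^-1 * \sum_(i < n) X_ind i f.

Definition Zstat {R : realType} (n s : nat) (f : {ffun 'I_n -> {ffun V s -> bool}}) : R :=
  Num.sqrt (n%:R) * (Xbar f - p_s s) / Num.sqrt (p_s s * (1 - p_s s)).

Definition Fdist {R : realType} (n s : nat) (x : R) : R :=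
  Prob [set f in Omega n s | Zstat f <= x].

Definition Phi {R : realType} (x : R) : R :=
  fine (normal_prob (0 : R) 1 `]-oo, x]%classic).

(* Main.v *)
Require Import Defs.
From HB Require Import structures.
From mathcomp Require Import all_boot all_order all_algebra.
From mathcomp Require Import all_classical all_reals all_analysis.
From mathcomp Require Import measurable_realfun.
From mathcomp Require Import ring lra zify.
Set Implicit Arguments.
Unset Strict Implicit.
Unset Printing Implicit Defensive.
Import Order.TTheory GRing.Theory Num.Theory.
Import numFieldNormedType.Exports.
Local Open Scope ring_scope.

(** A coloring in Omega_{m+1} is determined by its first m coordinates, which
are independent and uniform, so the first m indicators are i.i.d. Bernoulli(p)
and the last one only moves the normalised sum by at most the reciprocal d of
its standard deviation. The binomial sum is compared with the normal law by
Stein's method: for a ramp h decreasing from 1 at a to 0 at a + e, the equation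
f'(w) - w f(w) = h(w) - E h(N) has a solution with f, w f(w) and f' bounded
independently of a, and E[(S - mp) g(S)] = mp(1-p) E[g(S'+1) - g(S')], with S'
binomial on m - 1 trials, turns E[f'(W) - W f(W)] into an O(d (1 + 1/e)) error.
Since no bound depends on a, the convergence is uniform. *)

(** * Expectation under the binomial distribution *)

Section BinomialExpectation.
Context {R : realFieldType}.
Variable p : R.
Implicit Types (F G : nat -> R) (m : nat).

(** Conditioning on one trial gives the binomial mean without binomial coefficients, so the
    identities below follow by induction on the number of trials. *)
Fixpoint binmean m F : R :=
  if m is m'.+1 then p * binmean m' (fun k => F k.+1) + (1 - p) * binmean m' F
  else F 0%N.

Lemma binmeanS m F :
  binmean m.+1 F = p * binmean m (fun k => F k.+1) + (1 - p) * binmean m F.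
Proof. by []. Qed.

Lemma eq_binmean m F G : F =1 G -> binmean m F = binmean m G.
Proof.
by elim: m F G => [|m IH] F G FG /=; rewrite ?FG// (IH F G)//
  (IH (fun k => F k.+1) (fun k => G k.+1)).
Qed.

Lemma binmeanD m F G : binmean m (fun k => F k + G k) = binmean m F + binmean m G.
Proof. by elim: m F G => //= m IH F G; rewrite !IH; ring. Qed.

Lemma binmeanZ m c F : binmean m (fun k => c * F k) = c * binmean m F.
Proof. by elim: m F => //= m IH F; rewrite !IH; ring. Qed.

Lemma binmeanB m F G : binmean m (fun k => F k - G k) = binmean m F - binmean m G.
Proof. by elim: m F G => //= m IH F G; rewrite !IH; ring. Qed.

Lemma binmean_cst m c : binmean m (fun=> c) = c.
Proof. by elim: m => //= m IH; rewrite !IH; ring. Qed.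

(** Size-biasing: each of the [m.+1] trials succeeds with probability [p], and given its success the
    others still form a binomial variable on [m] trials. *)
Lemma binmean_size_bias m G :
  binmean m.+1 (fun k => k%:R * G k) = m.+1%:R * p * binmean m (fun k => G k.+1).
Proof.
elim: m G => [|m IH] G; first by rewrite /= mul0r; ring.
rewrite binmeanS (@eq_binmean _ _ (fun k => k%:R * G k.+1 + G k.+1)) => [|k]; last first.
  by rewrite -natr1 mulrDl mul1r.
by rewrite binmeanD (IH (fun k => G k.+1)) (IH G) (binmeanS m) -[m.+2%:R]natr1; ring.
Qed.

(** The binomial counterpart of Gaussian integration by parts. Size-biasing treats the term in
    [k%:R * G k], and conditioning on one trial treats the centring term. *)
Lemma binmean_stein m G :
  binmean m.+1 (fun k => (k%:R - m.+1%:R * p) * G k) =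
  m.+1%:R * p * (1 - p) * binmean m (fun k => G k.+1 - G k).
Proof.
rewrite (@eq_binmean _ _ (fun k => k%:R * G k - m.+1%:R * p * G k)) => [|k]; last by ring.
by rewrite (binmeanB _ (fun k => k%:R * G k)) (binmeanZ _ (m.+1%:R * p) G)
  binmean_size_bias binmeanS binmeanB; ring.
Qed.

Lemma binmean_sqr m c :
  binmean m (fun k => (k%:R - c) ^+ 2) = m%:R * p * (1 - p) + (m%:R * p - c) ^+ 2.
Proof.
elim: m c => [|m IH] c /=; first by ring.
rewrite (@eq_binmean _ _ (fun k => (k%:R - (c - 1)) ^+ 2)) => [|k].
  by rewrite !IH -natr1; ring.
by rewrite -natr1; ring.
Qed.

Hypothesis p01 : 0 <= p <= 1.

Lemma ler_binmean m F G : (forall k, F k <= G k) -> binmean m F <= binmean m G.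
Proof.
have /andP[p0 p1] := p01.
elim: m F G => //= m IH F G FG.
by rewrite lerD// ler_wpM2l ?subr_ge0// IH.
Qed.

Lemma ler_norm_binmean m F : `|binmean m F| <= binmean m (fun k => `|F k|).
Proof.
rewrite ler_norml; apply/andP; split; last by apply: ler_binmean => k; exact: ler_norm.
rewrite -[leLHS]mulN1r -binmeanZ; apply: ler_binmean => k.
by rewrite mulN1r lerNl -normrN ler_norm.
Qed.

End BinomialExpectation.

(** * The Gaussian distribution function *)

Section Gaussian.
Context {R : realType}.
Implicit Types (h : R -> R) (w t : R).
Local Notation phi := (normal_pdf (0 : R) 1).
Local Notation mu := (@lebesgue_measure R).

Lemma phi_gt0 w : 0 < phi w.
Proof. by rewrite normal_pdfE ?oner_neq0// mulr_gt0 ?expR_gt0// normal_peak_gt0 ?oner_neq0. Qed.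

Lemma is_derive_phi w : is_derive w 1 phi (- w * phi w).
Proof.
rewrite normal_pdfE ?oner_neq0//.
rewrite [X in is_derive _ _ X](_ : _ = (fun t => normal_peak 1 * expR (- t ^+ 2 / 2))); last first.
  by apply/funext => t; rewrite /normal_fun subr0 expr1n.
have d2 : is_derive w 1 (fun t : R => - t ^+ 2 / 2) (- w).
  by apply: is_derive_eq; rewrite /GRing.scale/=; field.
have := is_deriveZ (normal_peak 1) (is_derive1_comp (is_derive_expR _) d2).
move=> d; apply: is_derive_eq.
by rewrite /normal_fun subr0 expr1n /GRing.scale/=; ring.
Qed.

Lemma phi_sym w : phi (- w) = phi w.
Proof. by rewrite normal_pdfE ?oner_neq0// /normal_fun !subr0 sqrrN. Qed.

(** The Gaussian mean of [h] truncated at [w]; it is the full mean as soon as [h] vanishes beyond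
    [w]. *)
Definition gauss_int h w : R := \int[mu]_(t in `]-oo, w]%classic) (h t * phi t).

(** Continuity makes [gauss_int h] differentiable everywhere; the range [0, 1] lets the normal
    density dominate the integrand. *)
Definition unit_weight h := continuous h /\ forall t, 0 <= h t <= 1.

Lemma weight_integrable h (A : set R) : measurable A -> unit_weight h ->
  mu.-integrable A (EFin \o (fun t => h t * phi t)).
Proof.
move=> mA [ch h01].
apply: (@integrableS _ _ _ mu setT) => //.
apply: (le_integrable _ _ _ (integrable_normal_pdf (0 : R) 1)) => //.
- apply/measurable_EFinP; apply: measurable_funM.
  + exact: continuous_measurable_fun.
  + exact: measurable_normal_pdf.
- move=> t _ /=; rewrite lee_fin normrM ler_piMl ?normr_ge0//.
  by have /andP[h0 h1] := h01 t; rewrite ger0_norm.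
Qed.

Lemma is_derive_gauss_int h w : unit_weight h -> is_derive w 1 (gauss_int h) (h w * phi w).
Proof.
move=> wh; have [ch _] := wh.
have w1 : w < w + 1 by rewrite ltrDl ltr01.
have [] := @continuous_FTC1 R (fun t => h t * phi t) -oo%O w (w + 1) w1.
- exact: weight_integrable.
- by rewrite ltNyr.
- by apply: cvgM; [exact: ch|exact: continuous_normal_pdf (oner_neq0 _) _].
- by rewrite derive1E => dF <-; exact: DeriveDef.
Qed.

Lemma PhiE w : Phi w = gauss_int (fun=> 1) w.
Proof. by rewrite /gauss_int /Rintegral; under eq_integral do rewrite mul1r. Qed.

Lemma weight1 : unit_weight (fun=> 1).
Proof. split; [exact: cst_continuous|by move=> t; rewrite ler01 lexx]. Qed.

Lemma is_derive_Phi w : is_derive w 1 Phi (phi w).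
Proof.
rewrite -[phi w]mul1r (_ : Phi = gauss_int (fun=> 1)).
  exact: is_derive_gauss_int weight1.
by apply/funext => x; rewrite PhiE.
Qed.

(** The identity map has the normal law as its distribution, so general facts on [cdf] supply the
    bounds of [Phi] and its limits at both infinities. *)
Lemma Phi_is_cdf : exists X : {RV (normal_prob (0 : R) 1) >-> R},
  forall w, cdf X w = (Phi w)%:E.
Proof.
have mid : measurable_fun setT (idfun : measurableTypeR R -> R).
  exact: measurable_id.
pose X : {RV (normal_prob (0 : R) 1) >-> R} :=
  HB.pack (idfun : measurableTypeR R -> R) (isMeasurableFun.Build _ _ _ _ _ mid).
exists X => w; rewrite /cdf/= /pushforward preimage_id /Phi fineK//.
exact: fin_num_measure.
Qed.

Lemma Phi_ge0 w : 0 <= Phi w :> R.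
Proof. by have [X XE] := Phi_is_cdf; rewrite -lee_fin -XE cdf_ge0. Qed.

Lemma Phi_le1 w : Phi w <= 1 :> R.
Proof. by have [X XE] := Phi_is_cdf; rewrite -lee_fin -XE cdf_le1. Qed.

Lemma Phi_small w (e : R) : 0 < e -> exists2 u, u <= w & Phi u < e.
Proof.
move=> e0; have [X XE] := Phi_is_cdf; have := cvg_cdfNy0 X.
rewrite (_ : cdf X = EFin \o Phi); last by apply/funext => x; rewrite XE.
move=> /fine_cvgP[_ /cvgrPdist_lt /(_ _ e0) cvg0].
have [u []] := filter_ex (filterI (nbhs_ninfty_le (num_real w)) cvg0).
by rewrite sub0r normrN => uw /ltr_normlW; exists u.
Qed.

Lemma Phi_large w (e : R) : 0 < e -> exists2 u, w <= u & 1 - Phi u < e.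
Proof.
move=> e0; have [X XE] := Phi_is_cdf; have := cvg_cdfy1 X.
rewrite (_ : cdf X = EFin \o Phi); last by apply/funext => x; rewrite XE.
move=> /fine_cvgP[_ /cvgrPdist_lt /(_ _ e0) cvg0].
have [u []] := filter_ex (filterI (nbhs_pinfty_ge (num_real w)) cvg0).
by move=> uw /ltr_normlW; exists u.
Qed.

Lemma MVT_is_derive (f df : R -> R) (a b : R) : a <= b ->
  (forall x, a <= x <= b -> is_derive x 1 f (df x)) ->
  exists2 c, a <= c <= b & f b - f a = df c * (b - a).
Proof.
move=> ab fd; have [|//|c cab E] := @MVT_segment _ f df a b ab.
- by move=> x /[!in_itv]/= /andP[/ltW ax /ltW xb]; apply: fd; rewrite ax xb.
- by apply: derivable_within_continuous => x /[!in_itv]/= /fd[].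
- by exists c => //; rewrite in_itv/= in cab.
Qed.

Lemma phi_le1 w : phi w <= 1.
Proof.
apply: (le_trans (normal_pdf_ub _ _ (oner_neq0 _))).
rewrite /normal_peak expr1n mul1r; have pi2 := pi_ge2 R.
have pi21 : 1 <= pi *+ 2 :> R by rewrite mulr2n; lra.
by rewrite invf_le1 ?sqrtr_gt0 ?(lt_le_trans ltr01)// -[leLHS]sqrtr1 ler_wsqrtr.
Qed.

Lemma Phi_increment (x d : R) : 0 <= d -> Phi (x + d) - Phi x <= d.
Proof.
move=> d0; have xd : x <= x + d by rewrite lerDl.
have [c _ ->] := MVT_is_derive xd (fun c _ => is_derive_Phi c).
by rewrite addrAC subrr add0r ler_piMl// phi_le1.
Qed.

(** * Mills-ratio estimates for a Gaussian tail *)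

Section Mills.
Variable G : R -> R.
Hypothesis dG : forall w, is_derive w 1 G (phi w).
Hypothesis G_small : forall w e, 0 < e -> exists2 u, u <= w & G u < e.

(* [G x + phi x / x] decreases on the negative half-line, where its second term
is negative, so it stays below the infimum of [G] at -oo. *)
Lemma mills_ratio w : w <= 0 -> - w * G w <= phi w.
Proof.
rewrite le_eqVlt => /orP[/eqP->|w0]; first by rewrite oppr0 mul0r ltW// phi_gt0.
suff : G w + phi w / w <= 0.
  rewrite -(ler_nM2r w0) mul0r mulrDl divfK ?lt_eqF// => ?; lra.
apply/ler_addgt0Pr => e e0; rewrite add0r.
have [u uw Gu] := G_small w e0.
pose g x := G x + phi x / x.
have dg x : u <= x <= w -> is_derive x 1 g (- phi x / x ^+ 2).
  move=> /andP[ux xw]; have x0 : x != 0 by rewrite lt_eqF// (le_lt_trans xw).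
  have dV : is_derive x 1 (fun y : R => y^-1) (- x ^- 2).
    apply: is_derive_eq; first exact: (is_deriveV x0 (is_derive_id _ _)).
    by rewrite /GRing.scale/= mulr1.
  apply: is_derive_eq; first exact: (is_deriveD (dG x) (is_deriveM (is_derive_phi x) dV)).
  by rewrite /GRing.scale/=; field.
have [c _ gE] := MVT_is_derive uw dg.
have u0 : u < 0 by exact: le_lt_trans uw w0.
have gwu : g w <= g u.
  rewrite -subr_le0 gE !mulNr oppr_le0 mulr_ge0 ?subr_ge0// divr_ge0 ?sqr_ge0//.
  by rewrite ltW// phi_gt0.
rewrite -/(g w) (le_trans gwu)// (le_trans _ (ltW Gu))// /g gerDl.
by rewrite pmulr_rle0 ?phi_gt0// invr_le0 ltW.
Qed.

(** The summand 1 serves [w <= -1], where the Mills ratio gives [G w <= phi w]; the summand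
    [(phi 1)^-1] serves -1 < w <= 0, where [phi w] is at least [phi 1]. *)
Definition mills_cst := 1 + (phi 1)^-1.

Lemma mills_bound w : (forall x, G x <= 1) -> w <= 0 -> G w <= mills_cst * phi w.
Proof.
move=> G1 w0; have phi1 := phi_gt0 1; have phiw := phi_gt0 w.
have [w1|w1] := leP w (-1).
  rewrite mulrDl mul1r (@le_trans _ _ (phi w))//; last first.
    by rewrite lerDl mulr_ge0// ?ltW// invr_gt0.
  have Gw := mills_ratio w0; have [G0|G0] := leP 0 (G w); last by lra.
  by nra.
have : phi 1 <= phi w.
  rewrite normal_pdfE ?oner_neq0// ler_pM2l ?normal_peak_gt0 ?oner_neq0//.
  rewrite /normal_fun !subr0 expr1n ler_expR !mulNr lerN2 ler_pM2r ?invr_gt0//.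
  by nra.
rewrite -(ler_pM2l (_ : 0 < (phi 1)^-1)) ?invr_gt0// mulVf ?gt_eqF// => le1.
by rewrite mulrDl mul1r (le_trans (G1 w))// (le_trans le1)// lerDr ltW.
Qed.
End Mills.

End Gaussian.

(** * The Stein equation *)

Section SteinEquation.
Context {R : realType}.
Implicit Types (h : R -> R) (w t : R).
Local Notation phi := (normal_pdf (0 : R) 1).

Lemma gauss_int_ge0 h w : unit_weight h -> 0 <= gauss_int h w.
Proof.
move=> [_ h01]; apply: Rintegral_ge0 => t _.
by rewrite mulr_ge0 ?(ltW (phi_gt0 _))//; have /andP[] := h01 t.
Qed.

Lemma gauss_int_le_Phi h w : unit_weight h -> gauss_int h w <= Phi w.
Proof.
move=> wh; have [_ h01] := wh.
rewrite PhiE; apply: le_Rintegral => //.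
- exact: weight_integrable.
- exact: weight_integrable weight1.
- by move=> t _; rewrite ler_wpM2r ?(ltW (phi_gt0 _))//; have /andP[] := h01 t.
Qed.

Lemma gauss_int_ndecr h x y : unit_weight h -> x <= y -> gauss_int h x <= gauss_int h y.
Proof.
move=> wh xy; have [c _ E] := MVT_is_derive xy (fun c _ => is_derive_gauss_int c wh).
rewrite -subr_ge0 E mulr_ge0 ?subr_ge0// mulr_ge0 ?(ltW (phi_gt0 _))//.
by have [_ /(_ c)/andP[]] := wh.
Qed.

Lemma gauss_int_eq_Phi h w : (forall t, t <= w -> h t = 1) -> gauss_int h w = Phi w.
Proof.
move=> h1; rewrite PhiE; apply: eq_Rintegral => t.
by rewrite inE/= in_itv/= => /h1 ->.
Qed.

Lemma Phi_mills w : w <= 0 -> Phi w <= mills_cst * phi w /\ `|w| * Phi w <= phi w.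
Proof.
move=> w0; rewrite ler0_norm//; split.
- by apply: mills_bound => //; [exact: is_derive_Phi|exact: Phi_small|exact: Phi_le1].
- by apply: mills_ratio => //; [exact: is_derive_Phi|exact: Phi_small].
Qed.

(** By symmetry of [phi], the reflected upper tail [1 - Phi (- x)] satisfies the same hypotheses as
    [Phi], so the left-tail estimates transfer. *)
Lemma PhiC_mills w : 0 <= w ->
  1 - Phi w <= mills_cst * phi w /\ `|w| * (1 - Phi w) <= phi w.
Proof.
move=> w0; pose G (x : R) : R := 1 - Phi (- x).
have dG (x : R) : is_derive x 1 G (phi x).
  rewrite -phi_sym.
  have dN : is_derive x 1 (fun y : R => - y) (-1) by exact: is_deriveNid.
  have d1 : is_derive x 1 (fun=> 1 : R) 0 by exact: is_derive_cst.
  have d := is_deriveB d1 (is_derive1_comp (is_derive_Phi (- x)) dN).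
  by apply: is_derive_eq; rewrite /GRing.scale/=; ring.
have sG (x e : R) : 0 < e -> exists2 u, u <= x & G u < e.
  by move=> /(Phi_large (- x))[u xu ue]; exists (- u); [lra|rewrite /G opprK].
have Nw : - w <= 0 by rewrite oppr_le0.
have -> : 1 - Phi w = G (- w) by rewrite /G opprK.
rewrite ger0_norm// -(phi_sym w); split.
- by apply: mills_bound => // x; rewrite gerBl Phi_ge0.
- by rewrite -[X in X * _]opprK; exact: mills_ratio.
Qed.

(** With the integrating factor [phi] the equation says that [f * phi] has derivative
    [(h - m) * phi]. Hence [f] is [N / phi], and the Mills estimates bound it because [N] is
    controlled by the tail on either side. *)
Lemma stein_solution h b : unit_weight h -> (forall t, b <= t -> h t = 0) ->
  exists f : R -> R,
    [/\ forall w, is_derive w 1 f (h w - gauss_int h b + w * f w),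
        forall w, `|f w| <= mills_cst & forall w, `|w * f w| <= 1].
Proof.
move=> wh h0; have [_ h01] := wh; set m := gauss_int h b.
pose N w := gauss_int h w - m * Phi w.
have phin0 w : phi w != 0 by rewrite gt_eqF// phi_gt0.
have m0 : 0 <= m by exact: gauss_int_ge0.
have m1 : m <= 1 by rewrite (le_trans (gauss_int_le_Phi b wh))// Phi_le1.
(* The difference [m - gauss_int h w] is the mass of [h] between [w] and [b], at most the normal
   mass there; it is zero beyond [b]. *)
have tail w : 0 <= m - gauss_int h w <= 1 - Phi w.
  have [wb|bw] := leP w b; last first.
    have [c /andP[bc _]] := MVT_is_derive (ltW bw) (fun c _ => is_derive_gauss_int c wh).
    rewrite h0// !mul0r -/m => /eqP; rewrite subr_eq0 => /eqP ->.
    by rewrite subrr lexx subr_ge0 Phi_le1.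
  have [c _ mE] := MVT_is_derive wb (fun c _ => is_derive_gauss_int c wh).
  have [c' _] := MVT_is_derive wb
    (fun c _ => is_deriveB (is_derive_Phi c) (is_derive_gauss_int c wh)).
  have -> : (Phi - gauss_int h) b - (Phi - gauss_int h) w =
    (Phi b - m) - (Phi w - gauss_int h w) by [].
  move=> PE; rewrite mE mulr_ge0 ?subr_ge0//; last first.
    by rewrite mulr_ge0 ?(ltW (phi_gt0 _))//; have /andP[] := h01 c.
  have : 0 <= (Phi b - m) - (Phi w - gauss_int h w).
    rewrite PE mulr_ge0 ?subr_ge0// ler_piMl ?(ltW (phi_gt0 _))//.
    by have /andP[] := h01 c'.
  by rewrite -mE -/m; have := Phi_le1 b; lra.
(* [B] is the tail on the side of [w]. On the right, [N w] equals [m * (1 - Phi w)] minus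
   [m - gauss_int h w], two numbers between 0 and [1 - Phi w]. *)
have NB w : exists B, [/\ `|N w| <= B, B <= mills_cst * phi w & `|w| * B <= phi w].
  have [w0|/ltW w0] := leP w 0.
  - have [B1 B2] := Phi_mills w0; exists (Phi w); split=> //.
    have := gauss_int_ge0 w wh; have := gauss_int_le_Phi w wh; have := Phi_ge0 w.
    move=> P0 HP H0; have := mulr_ge0 m0 P0; have := ler_piMl P0 m1.
    by rewrite /N ler_norml => ? ?; apply/andP; split; lra.
  - have [B1 B2] := PhiC_mills w0; exists (1 - Phi w); split=> //.
    have /andP[t0 t1] := tail w.
    have P0 : 0 <= 1 - Phi w by rewrite subr_ge0 Phi_le1.
    have := mulr_ge0 m0 P0; have := ler_piMl P0 m1.
    by rewrite /N ler_norml mulrBr mulr1 => ? ?; apply/andP; split; lra.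
exists (fun w => N w / phi w); split => w.
- have dV : is_derive w 1 (fun y : R => (phi y)^-1) (- (phi w) ^- 2 *: (- w * phi w)).
    exact: (is_deriveV (phin0 w) (is_derive_phi w)).
  have dN : is_derive w 1 N (h w * phi w - m * phi w).
    exact: (is_deriveB (is_derive_gauss_int w wh) (is_deriveZ m (is_derive_Phi w))).
  have d := is_deriveM dN dV. apply: (is_derive_eq d).
  by rewrite /GRing.scale/=; field.
- have [B [NB1 NB2 _]] := NB w.
  rewrite normrM normfV (gtr0_norm (phi_gt0 w)) ler_pdivrMr ?phi_gt0//.
  exact: le_trans NB1 NB2.
- have [B [NB1 _ NB3]] := NB w.
  rewrite !normrM normfV (gtr0_norm (phi_gt0 w)) mulrA ler_pdivrMr ?phi_gt0// mul1r.
  by rewrite (le_trans _ NB3)// ler_wpM2l.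
Qed.

Definition ramp (a e t : R) : R := Num.min 1 (Num.max 0 ((a + e - t) / e)).

Lemma ramp_weight a e : unit_weight (ramp a e).
Proof.
split; last first.
  by move=> t; rewrite /ramp le_min ge_min lexx ler01/= le_max lexx.
move=> t; apply: (@continuous_min _ _ (fun=> 1) (fun t => Num.max 0 ((a + e - t) / e))).
  exact: cst_continuous.
apply: (@continuous_max _ _ (fun=> 0) (fun t => (a + e - t) / e)).
  exact: cst_continuous.
apply: cvgM; last exact: cvg_cst.
by apply: cvgB; [exact: cvg_cst|exact: cvg_id].
Qed.

Lemma ramp1 a e t : 0 < e -> t <= a -> ramp a e t = 1.
Proof.
move=> e0 ta; rewrite /ramp; have le1 : 1 <= (a + e - t) / e.
  by rewrite ler_pdivlMr// mul1r; lra.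
by rewrite max_r ?(le_trans ler01)// min_l.
Qed.

Lemma ramp0 a e t : 0 < e -> a + e <= t -> ramp a e t = 0.
Proof.
move=> e0 ta; rewrite /ramp max_l ?min_r//.
by rewrite ler_pdivrMr// mul0r; lra.
Qed.

(** Clamping to [0, 1] is 1-Lipschitz and the clamped affine function has slope [- e^-1]. *)
Lemma ramp_lip a e t u : 0 < e -> `|ramp a e t - ramp a e u| <= e^-1 * `|t - u|.
Proof.
move=> e0; have -> : e^-1 * `|t - u| = `|(a + e - t) / e - (a + e - u) / e|.
  rewrite -mulrBl normrM mulrC (gtr0_norm (_ : 0 < e^-1)) ?invr_gt0// distrC.
  by congr (`|_| * _); ring.
have lip (x y : R) : x <= y ->
    `|Num.min 1 (Num.max 0 x) - Num.min 1 (Num.max 0 y)| <= `|x - y|.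
  move=> xy; rewrite (ler0_norm (_ : x - y <= 0)) ?subr_le0// ler_norml.
  rewrite !minElt !maxElt; case: (ltP 0 x) => ?; case: (ltP 0 y) => ?;
    rewrite ?ltr10; try case: (ltP 1 x) => ?; try case: (ltP 1 y) => ?;
    by apply/andP; split; lra.
rewrite /ramp; have [|/ltW] := leP ((a + e - t) / e) ((a + e - u) / e); first exact: lip.
by move=> ?; rewrite distrC [leRHS]distrC; exact: lip.
Qed.

End SteinEquation.

(** * Quantitative comparison of the binomial and normal laws *)

Section SteinBound.
Context {R : realType}.

(** The increment splits into [w] times that of [f], where the mean value theorem and the bound 2 on
    the derivative apply, the term [(t - w) * f t], and the increment of [h]. *)
Lemma stein_derivative_increment (h f : R -> R) (m C L w t d : R) :
  (forall x, 0 <= h x <= 1) -> 0 <= m <= 1 ->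
  (forall x y, `|h x - h y| <= L * `|x - y|) ->
  (forall x : R, is_derive x 1 f (h x - m + x * f x)) ->
  (forall x, `|f x| <= C) -> (forall x, `|x * f x| <= 1) ->
  w <= t <= w + d ->
  `|(h t - m + t * f t) - (h w - m + w * f w)| <= d * (2 * `|w| + C + L).
Proof.
move=> h01 /andP[m0 m1] hL df fC xf /andP[wt td].
have d0 : 0 <= t - w by rewrite subr_ge0.
have dd : t - w <= d by rewrite lerBlDl.
have L0 : 0 <= L.
  by have := hL 1 0; rewrite subr0 normr1 mulr1; apply: le_trans.
have [c _ fE] := MVT_is_derive wt (fun c _ => df c).
have df2 : `|h c - m + c * f c| <= 2.
  rewrite (le_trans (ler_normD _ _))// (_ : 2 = 1 + 1)// lerD//.
  by have /andP[? ?] := h01 c; rewrite ler_norml; apply/andP; split; lra.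
have -> : (h t - m + t * f t) - (h w - m + w * f w) =
  w * (f t - f w) + (t - w) * f t + (h t - h w) by ring.
have C0 : 0 <= C by exact: le_trans (fC 0).
rewrite (le_trans (ler_normD _ _))// (le_trans (lerD (ler_normD _ _) (hL t w)))//.
rewrite fE !normrM (ger0_norm d0) !(mulrDr d); apply: lerD; first apply: lerD.
- by rewrite [leRHS](_ : _ = `|w| * (2 * d)) ?ler_wpM2l ?ler_pM//; ring.
- by rewrite ler_pM.
- by rewrite mulrC ler_wpM2r.
Qed.

Variables (p : R) (k : nat) (d : R).
Hypothesis p01 : 0 < p < 1.
Hypothesis d01 : 0 < d <= 1.
Hypothesis dE : d ^+ 2 * k.+2%:R * (p * (1 - p)) = 1.
Local Notation W j := ((j%:R - k.+1%:R * p) * d).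

(** Here [d] standardises [k.+2] trials while the binomial variable has only [k.+1], one fluid being
    determined by the rest; the mismatch is absorbed in the error. *)
Lemma binmean_ramp_bound (a e : R) : 0 < e ->
  `|binmean p k.+1 (fun j => ramp a e (W j)) - gauss_int (ramp a e) (a + e)|
    <= d * (14 + 2 * mills_cst + 2 * e^-1).
Proof.
move=> e0; have /andP[p0 p1] := p01; have /andP[d0 d1] := d01.
have d0' := ltW d0; have p01' : 0 <= p <= 1 by rewrite !ltW.
set h := ramp a e; set m := gauss_int h _.
have wh : unit_weight h := ramp_weight a e.
have m01 : 0 <= m <= 1.
  by rewrite gauss_int_ge0//= (le_trans (gauss_int_le_Phi _ wh))// Phi_le1.
have [f [df fC xf]] := stein_solution wh (fun t => @ramp0 _ a e t e0).
rewrite -/m in df.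
pose g x := h x - m + x * f x.
have Wlin j : W j.+1 = W j + d by rewrite -natr1; ring.
(* Pointwise [h x - m] is [g x - x * f x]. One trial is conditioned out of the mean of [g], and
   [binmean_stein] rewrites the other term, so both become means over [k] trials. *)
have -> : binmean p k.+1 (fun j => h (W j)) - m =
    binmean p k (fun j => p * g (W j + d) + (1 - p) * g (W j)
      - d * (k.+1%:R * p * (1 - p)) * (f (W j + d) - f (W j))).
  transitivity (binmean p k.+1 (fun j => g (W j)) -
      d * binmean p k.+1 (fun j => (j%:R - k.+1%:R * p) * f (W j))).
    rewrite -[m in LHS](binmean_cst p k.+1) -binmeanB -binmeanZ -binmeanB.
    by apply: eq_binmean => j; rewrite /g; ring.
  rewrite (binmean_stein p k (fun j => f (W j))) mulrA binmeanS -!binmeanZ -binmeanD -binmeanB.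
  by apply: eq_binmean => j; rewrite Wlin; ring.
(* The variance of [k.+1] trials, scaled by [d ^+ 2], falls short of 1 by the contribution of a
   single trial. *)
have kd j : d * (k.+1%:R * p * (1 - p)) * (f (W j + d) - f (W j)) =
    (1 - d ^+ 2 * (p * (1 - p))) * ((f (W j + d) - f (W j)) / d).
  have -> : 1 - d ^+ 2 * (p * (1 - p)) = d ^+ 2 * k.+1%:R * (p * (1 - p)).
    by rewrite -[X in X - _]dE -[k.+2%:R]natr1; ring.
  by field; exact: lt0r_neq0.
pose M (x : R) := d * (2 * `|x| + mills_cst + e^-1).
have gM (x t : R) : x <= t <= x + d -> `|g t - g x| <= M x.
  apply: stein_derivative_increment => //; first by case: wh.
  by move=> y z; exact: ramp_lip.
have M0 (x : R) : 0 <= M x.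
  by apply: le_trans (gM x x _); rewrite ?normr_ge0// lexx lerDl ltW.
have g2 (x : R) : `|g x| <= 2.
  rewrite (le_trans (ler_normD _ _))// (_ : 2 = 1 + 1)// lerD//.
  have /andP[? ?] := m01; have /andP[? ?] := wh.2 x.
  by rewrite ler_norml; apply/andP; split; lra.
have pq1 : p * (1 - p) <= 1 by rewrite mulr_ile1//; lra.
have pq0 : 0 <= p * (1 - p) by rewrite mulr_ge0//; lra.
apply: (le_trans (ler_norm_binmean p01' _ _)).
(* Two increments of [g] cost [2 * M x] and the variance mismatch costs [2 * d]; then
   [|x| <= 1 + x ^+ 2] reduces the mean to a second moment. *)
apply: (@le_trans _ _ (binmean p k (fun j => 4 * d * (W j) ^+ 2 +
    d * (6 + 2 * mills_cst + 2 * e^-1)))).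
  apply: ler_binmean => // j; rewrite kd.
  set x := W j.
  have xd : x <= x + d by rewrite lerDl ltW.
  have [c xcd fE] := MVT_is_derive xd (fun c _ => df c).
  have -> : (f (x + d) - f x) / d = g c.
    by rewrite fE -/(g c) addrAC subrr add0r mulfK// gt_eqF.
  have -> : p * g (x + d) + (1 - p) * g x - (1 - d ^+ 2 * (p * (1 - p))) * g c =
     p * (g (x + d) - g x) - (g c - g x) + d ^+ 2 * (p * (1 - p)) * g c by ring.
  have b1 : `|p * (g (x + d) - g x)| <= M x.
    rewrite normrM (gtr0_norm p0) -[leRHS]mul1r ler_pM ?(ltW p0) ?(ltW p1)//.
    by apply: gM; rewrite xd lexx.
  have b2 : `|g c - g x| <= M x by exact: gM.
  have b3 : `|d ^+ 2 * (p * (1 - p)) * g c| <= d * 2.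
    have dpq0 : 0 <= d ^+ 2 * (p * (1 - p)) by exact: mulr_ge0 (sqr_ge0 _) pq0.
    rewrite normrM (ger0_norm dpq0) ler_pM//.
    by rewrite expr2 -mulrA ler_piMr ?(ltW d0)// mulr_ile1 ?(ltW d0).
  rewrite (le_trans (ler_normD _ _))// (le_trans (lerD (ler_normB _ _) b3))//.
  rewrite (le_trans (lerD (lerD b1 b2) (lexx _)))//.
  have x2 : `|x| <= 1 + x ^+ 2.
    by rewrite -real_normK ?num_real//; have := sqr_ge0 (`|x| - 1); nra.
  rewrite /M -/x.
  have := ler_wpM2l (ltW d0) x2; lra.
rewrite binmeanD binmean_cst binmeanZ.
(* Centring [k] trials at the mean of [k.+1] trials creates a bias [p], hence the extra [p ^+ 2]. *)
have -> : binmean p k (fun j => W j ^+ 2) = d ^+ 2 * (k%:R * p * (1 - p) + p ^+ 2).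
  transitivity (d ^+ 2 * binmean p k (fun j => (j%:R - k.+1%:R * p) ^+ 2)).
    by rewrite -binmeanZ; apply: eq_binmean => j; ring.
  by rewrite binmean_sqr -natr1; congr (_ * _); ring.
have v2 : d ^+ 2 * (k%:R * p * (1 - p) + p ^+ 2) <= 2.
  have d2 : 0 <= d ^+ 2 by exact: sqr_ge0.
  have : d ^+ 2 <= 1 by rewrite expr_le1// ltW.
  have pp : p ^+ 2 <= 1 by rewrite expr_le1// ltW.
  have := mulr_ge0 d2 pq0; have := ler_pM d2 (sqr_ge0 p) (lexx _) pp.
  have : d ^+ 2 * (k%:R * p * (1 - p)) + 2 * (d ^+ 2 * (p * (1 - p))) = 1.
    by rewrite -[RHS]dE -!natr1; ring.
  by rewrite mulrDr; lra.
(* The second moment thus contributes [8 * d], which with the earlier 6 makes the constant 14. *)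
have : 4 * d * (d ^+ 2 * (k%:R * p * (1 - p) + p ^+ 2)) <= 4 * d * 2.
  by rewrite ler_wpM2l// mulr_ge0// ltW.
lra.
Qed.

End SteinBound.

(** * Colorings *)

Section SumFfun.
Context {T : finType} {R : realFieldType}.

Definition fcons (m : nat) (x : T * {ffun 'I_m -> T}) : {ffun 'I_m.+1 -> T} :=
  [ffun i => if unlift ord0 i is Some j then x.2 j else x.1].

Lemma fcons_bij m : bijective (@fcons m).
Proof.
exists (fun g : {ffun 'I_m.+1 -> T} => (g ord0, [ffun j => g (lift ord0 j)])).
  move=> [c g] /=; rewrite /fcons ffunE unlift_none; congr pair.
  by apply/ffunP => j; rewrite !ffunE liftK.
move=> g; apply/ffunP => i; rewrite ffunE.
by case: unliftP => [j ->|->] //=; rewrite ffunE.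
Qed.

(** Splitting off the first coordinate and sorting its values by [Y] reproduces the recursion of
    [binmean], up to a factor [#|T|] for each coordinate. *)
Lemma sum_ffun_binmean (Y : pred T) (m : nat) (F : nat -> R) :
  (0 < #|T|)%N ->
  \sum_(g : {ffun 'I_m -> T}) F (\sum_(i < m) (Y (g i) : nat))%N =
  #|T|%:R ^+ m * binmean (#|[pred c | Y c]|%:R / #|T|%:R) m F.
Proof.
move=> T0; elim: m F => [|m IH] F.
  rewrite expr0 mul1r /=.
  under eq_bigr do rewrite big_ord0.
  by rewrite sumr_const card_ffun card_ord expn0.
rewrite (reindex (@fcons m)) /=; last exact/onW_bij/fcons_bij.
rewrite (eq_bigr (fun x : T * {ffun 'I_m -> T} =>
  F (Y x.1 + \sum_(i < m) (Y (x.2 i) : nat))%N)); last first.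
  move=> [c g] _ /=; congr F; rewrite big_ord_recl ffunE unlift_none; congr addn.
  by apply: eq_bigr => i _; rewrite ffunE liftK.
rewrite -(pair_bigA _ (fun c (g : {ffun 'I_m -> T}) =>
  F (Y c + \sum_(i < m) (Y (g i) : nat))%N)) /=.
rewrite (bigID Y) /=.
rewrite (eq_bigr (fun=> #|T|%:R ^+ m *
  binmean (#|[pred c | Y c]|%:R / #|T|%:R) m (fun k => F k.+1))); last first.
  by move=> c Yc; rewrite -(IH (fun k => F k.+1)) Yc.
rewrite [X in _ + X](eq_bigr (fun=> #|T|%:R ^+ m *
  binmean (#|[pred c | Y c]|%:R / #|T|%:R) m F)); last first.
  by move=> c /negbTE Yc; rewrite -IH Yc.
have sumC (P : pred T) (b : R) : \sum_(c | P c) b = #|[pred c | P c]|%:R * b.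
  by rewrite sumr_const mulr_natl.
rewrite !sumC.
have -> : #|[pred c | ~~ Y c]|%:R = #|T|%:R - #|[pred c | Y c]|%:R :> R.
  rewrite -(cardC [pred c | Y c]) natrD addrC addKr.
  by congr (_%:R); apply: eq_card => c; rewrite !inE.
have Tn0 : #|T|%:R != 0 :> R by rewrite pnatr_eq0 -lt0n.
rewrite exprS.
set b1 := binmean _ _ _; set b2 := binmean _ _ _.
set t := #|T|%:R in Tn0 *; set y := #|_|%:R.
by field.
Qed.
End SumFfun.

(** * Flow of a single fluid and the parity constraint *)

Section Percolation.
Variable s : nat.
Local Notation T := {ffun V s -> bool}.

(** The flow condition involves only the coloring of one fluid; isolating it lets the indicators be
    read as functions of independent coordinates. *)
Definition percolates (c : T) : bool :=
  `[< exists (x : V s) (p : seq (V s)),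
    [&& [exists o : Cell s, is_O o && cadj o (val x)],
        path (@vadj s) x p, uniq (x :: p),
        boundary (val (last x p)) & all (fun v => c v) (x :: p)] >].

Lemma flowsE n (f : {ffun 'I_n -> T}) i : `[< flows f i >] = percolates (f i).
Proof. by []. Qed.

Lemma percolates0 : ~~ percolates [ffun=> false].
Proof. by apply/asboolPn => -[x [p /and5P[_ _ _ _ /=]]]; rewrite ffunE. Qed.

(* The parity constraint determines the coloring of the last fluid. *)
Definition complete_coloring m (g : {ffun 'I_m -> T}) : {ffun 'I_m.+1 -> T} :=
  [ffun i => if unlift ord_max i is Some j then g j
             else [ffun v => ~~ odd (\sum_(j < m) (g j v : nat))]].

Lemma complete_coloring_lift m (g : {ffun 'I_m -> T}) j :
  complete_coloring g (lift ord_max j) = g j.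
Proof. by rewrite ffunE liftK. Qed.

Lemma sum_ord_max m (F : 'I_m.+1 -> nat) :
  (\sum_(i < m.+1) F i = \sum_(j < m) F (lift ord_max j) + F ord_max)%N.
Proof.
rewrite big_ord_recr /=; congr addn; apply: eq_bigr => j _; congr F.
by apply/val_inj; rewrite /= /bump leqNgt ltn_ord.
Qed.

Lemma complete_coloring_Omega m (g : {ffun 'I_m -> T}) : complete_coloring g \in Omega m.+1 s.
Proof.
rewrite inE; apply/forallP => v; rewrite sum_ord_max oddD.
under eq_bigr do rewrite complete_coloring_lift.
by rewrite ffunE unlift_none ffunE; case: (odd _).
Qed.

(** Completing a coloring and forgetting its last fluid are mutually inverse between free [m]-tuples
    and [Omega m.+1 s]. *)
Lemma sum_Omega (R : nmodType) m (F : {ffun 'I_m.+1 -> T} -> R) :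
  \sum_(f in Omega m.+1 s) F f = \sum_(g : {ffun 'I_m -> T}) F (complete_coloring g).
Proof.
rewrite (reindex_onto (@complete_coloring m)
  (fun f : {ffun 'I_m.+1 -> T} => [ffun j => f (lift ord_max j)])) => [|f].
  apply: eq_bigl => g; rewrite complete_coloring_Omega; apply/eqP/ffunP => j.
  by rewrite ffunE complete_coloring_lift.
rewrite inE => /forallP fO; apply/ffunP => i; rewrite ffunE.
case: unliftP => [j ->|->]; first by rewrite ffunE.
apply/ffunP => v; rewrite ffunE; move: (fO v); rewrite sum_ord_max oddD.
under [in X in _ -> X]eq_bigr do rewrite ffunE.
by case: (odd _); case: (f _ _).
Qed.

Lemma card_coloring : #|{: T}| = (2 ^ #|[set: V s]|)%N.
Proof. by rewrite card_ffun card_bool cardsT. Qed.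

Lemma card_coloring_gt0 : (0 < #|{: T}|)%N.
Proof. by rewrite card_coloring expn_gt0. Qed.

Lemma Prob_Omega (R : realType) m (P : pred {ffun 'I_m.+1 -> T}) :
  Prob [set f in Omega m.+1 s | P f] =
  \sum_(g : {ffun 'I_m -> T}) (P (complete_coloring g))%:R / #|{: T}|%:R ^+ m :> R.
Proof.
rewrite -mulr_suml -(sum_Omega (fun f => (P f)%:R)) /Prob /= card_coloring.
rewrite natrX -exprM mulnC; congr (_ / _).
rewrite -sum1_card natr_sum big_mkcond [in RHS]big_mkcond/=.
by apply: eq_bigr => f _; rewrite inE; case: (f \in _) => //=; case: (P f).
Qed.

Lemma p_s_percolates (R : realType) :
  p_s s = #|[pred c | percolates c]|%:R / #|{: T}|%:R :> R.
Proof.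
rewrite /p_s /event_A Prob_Omega -mulr_suml expr1.
have E := @sum_ffun_binmean _ R percolates 1 (fun k => k%:R) card_coloring_gt0.
rewrite (eq_bigr (fun g : {ffun 'I_1 -> T} => (\sum_(i < 1) (percolates (g i) : nat))%N%:R)).
  rewrite E /= expr1 mulr1 mulr0 addr0 mulrC mulKf//.
  by rewrite pnatr_eq0 -lt0n card_coloring_gt0.
move=> g _; rewrite big_ord_recl big_ord0 addn0 flowsE.
(* For two fluids the first one is the free coordinate, so its law is uniform. *)
rewrite -(complete_coloring_lift g ord0); congr ((percolates (complete_coloring _ _) : nat)%:R).
exact/val_inj.
Qed.

Hypothesis s2 : (2 <= s)%N.

Lemma exists_cell (k : nat) : (k <= s.-1)%N ->
  exists c : Cell s, cq c = k%:Z /\ cr c = 0.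
Proof.
move=> ks.
have k1 : (s.-1 + k < s.*2.-1)%N by lia.
have k2 : (s.-1 < s.*2.-1)%N by lia.
have q1 : Defs.coord s (Ordinal k1) = k%:Z by rewrite /Defs.coord /= PoszD addrC addKr.
have q2 : Defs.coord s (Ordinal k2) = 0 by rewrite /Defs.coord /= subrr.
have Mc : inM s (Ordinal k1, Ordinal k2).
  by rewrite /inM /hex_dist2 q1 q2 normr0 !addr0 -mulr2n lerMn2r lez_nat ks.
by exists (exist (fun c => inM s c) _ Mc); rewrite /cq /cr /= q1 q2.
Qed.

Lemma exists_vertex (k : nat) : (0 < k <= s.-1)%N ->
  exists v : V s, cq (val v) = k%:Z /\ cr (val v) = 0.
Proof.
move=> /andP[k0 /exists_cell[c [cqE crE]]].
have Oc : ~~ is_O c by rewrite /is_O cqE; lia.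
by exists (exist (fun c => ~~ is_O c) _ Oc).
Qed.

Lemma boundary_end (c : Cell s) : cq c = s.-1%:Z -> cr c = 0 -> boundary c.
Proof.
move=> cqE crE; rewrite /boundary.
(* The neighbour (s, 0) lies outside M_s. *)
pose nbs : seq (int * int) := [:: (s.-1%:Z - 1, 0); (s.-1%:Z, 1); (s.-1%:Z, -1);
   (s.-1%:Z + 1, -1); (s.-1%:Z - 1, 1)].
have inj : injective (fun d : Cell s => (cq d, cr d)).
  move=> d e [dq dr]; apply/val_inj/eqP; rewrite -pair_eqE /pair_eq/=.
  move: dq dr; rewrite /cq /cr /Defs.coord => /addIr[dq] /addIr[dr].
  by apply/andP; split; apply/eqP/val_inj.
rewrite cardE -(size_map (fun d : Cell s => (cq d, cr d))) (@leq_ltn_trans (size nbs))//.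
apply: uniq_leq_size; first by rewrite map_inj_uniq ?enum_uniq.
move=> _ /mapP[d + ->]; rewrite mem_enum inE /cadj /hex_adj cqE crE.
have dq : cq d <= s.-1%:Z.
  by rewrite /cq; move: (val d).1 => i; rewrite /Defs.coord; have := ltn_ord i; lia.
rewrite !inE !xpair_eqE; lia.
Qed.

(** The straight walk (1, 0), ..., (s - 1, 0) leads from a neighbour of the centre to the
    boundary. *)
Lemma percolates1 : percolates [ffun=> true].
Proof.
have [c0 [c0q c0r]] := exists_cell (leq0n _).
have [x [xq xr]] : exists v : V s, cq (val v) = 1 /\ cr (val v) = 0.
  by apply: (@exists_vertex 1); lia.
have conn k : (k < s.-1)%N ->
    exists v : V s, [/\ cq (val v) = k.+1%:Z, cr (val v) = 0 & connect (@vadj s) x v].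
  elim: k => [|k IH] ks; first by exists x; split=> //; exact: connect0.
  have [v [vq vr xv]] := IH (ltnW ks).
  have [w [wq wr]] : exists v : V s, cq (val v) = k.+2%:Z /\ cr (val v) = 0.
    by apply: exists_vertex; lia.
  exists w; split=> //; apply: (connect_trans xv); apply: connect1.
  by rewrite /vadj /cadj /hex_adj vq vr wq wr; lia.
have [v [vq vr /connectP[p xp vE]]] := conn s.-2 ltac:(lia).
(* Connectivity yields a walk; [shortenP] removes repetitions to obtain distinct cells. *)
apply/asboolP; move: vE; case/shortenP: xp => q xq' uq _ vE.
exists x, q; apply/and5P; split=> //.
- apply/existsP; exists c0; rewrite /is_O c0q c0r eqxx/= /cadj /hex_adj c0q c0r xq xr; lia.
- rewrite -vE; apply: boundary_end => //; rewrite vq; lia.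
- by apply/allP => w _; rewrite ffunE.
Qed.

(** The constant colorings witness that flow is neither impossible nor certain, so the variance
    [p_s s * (1 - p_s s)] is positive. *)
Lemma p_s_gt0 (R : realType) : 0 < p_s s :> R.
Proof.
rewrite p_s_percolates divr_gt0 ?ltr0n ?card_coloring_gt0//.
apply/card_gt0P; exists [ffun=> true]; exact: percolates1.
Qed.

Lemma p_s_lt1 (R : realType) : p_s s < 1 :> R.
Proof.
rewrite p_s_percolates ltr_pdivrMr ?ltr0n ?card_coloring_gt0// mul1r ltr_nat.
apply: proper_card; apply/properP; split; first exact: subset_predT.
by exists [ffun=> false] => //; exact: percolates0.
Qed.

(** The reciprocal standard deviation of a sum of [n] independent flow indicators; it plays the role
    of [d] in the Stein bound. *)
Definition inv_sd (R : realType) (n : nat) : R :=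
  (Num.sqrt n%:R * Num.sqrt (p_s s * (1 - p_s s)))^-1.

Lemma ZstatE (R : realType) m (g : {ffun 'I_m -> T}) :
  Zstat (complete_coloring g) =
  ((\sum_(j < m) (percolates (g j) : nat))%N%:R
   + (percolates (complete_coloring g ord_max))%:R - m.+1%:R * p_s s) * inv_sd R m.+1.
Proof.
rewrite /Zstat /Xbar /inv_sd invfM mulrA; congr (_ / _).
have n0 : Num.sqrt m.+1%:R != 0 :> R by rewrite gt_eqF// sqrtr_gt0 ltr0n.
have nE : m.+1%:R = Num.sqrt m.+1%:R ^+ 2 :> R by rewrite sqr_sqrtr.
have -> : \sum_(i < m.+1) X_ind i (complete_coloring g) =
  (\sum_(j < m) (percolates (g j) : nat))%N%:R + (percolates (complete_coloring g ord_max))%:R :> R.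
  rewrite -natrD.
  under [in RHS]eq_bigr do rewrite -complete_coloring_lift.
  rewrite -(sum_ord_max (fun i => percolates (complete_coloring g i))) natr_sum.
  by apply: eq_bigr => i _; rewrite /X_ind flowsE; case: percolates.
by set r := Num.sqrt _ in n0 nE *; rewrite nE; field.
Qed.

(** Asking for the bounds at every [z] in the window removes the dependent last fluid: whatever it
    does, [Zstat] stays within [inv_sd] of the standardised count of the free fluids. *)
Lemma Fdist_sandwich (R : realType) m (x : R) (F G : nat -> R) :
  (forall k z, `|z - (k%:R - m%:R * p_s s) * inv_sd R m.+1| <= inv_sd R m.+1 ->
    F k <= (z <= x)%R%:R <= G k) ->
  binmean (p_s s) m F <= Fdist m.+1 s x <= binmean (p_s s) m G.
Proof.
move=> FG; have T0 : 0 < #|{: T}|%:R ^+ m :> R by rewrite exprn_gt0// ltr0n card_coloring_gt0.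
rewrite /Fdist Prob_Omega -mulr_suml.
have bE (H : nat -> R) : binmean (p_s s) m H =
    (\sum_(g : {ffun 'I_m -> T}) H (\sum_(i < m) (percolates (g i) : nat))%N)
    / #|{: T}|%:R ^+ m.
  rewrite sum_ffun_binmean; last exact: card_coloring_gt0.
  rewrite p_s_percolates [RHS]mulrC mulKf// gt_eqF//.
rewrite !bE !ler_pM2r ?invr_gt0//.
suff H (g : {ffun 'I_m -> T}) : F (\sum_(i < m) (percolates (g i) : nat))%N <=
    (Zstat (complete_coloring g) <= x)%R%:R <= G (\sum_(i < m) (percolates (g i) : nat))%N.
  by apply/andP; split; apply: ler_sum => g _; have /andP[] := H g.
(* The two standardised sums differ by the last indicator minus [p_s s], of absolute value at most
   1, times [inv_sd]. *)
apply: FG; rewrite ZstatE -mulrBl normrM.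
have d0 : 0 <= inv_sd R m.+1 by rewrite invr_ge0 mulr_ge0// sqrtr_ge0.
rewrite [X in _ * X]ger0_norm// ler_piMl//.
have := p_s_gt0 R; have := p_s_lt1 R; rewrite -natr1 => p1 p0.
set S := _%:R; set b := _%:R.
have -> : S + b - (m%:R + 1) * p_s s - (S - m%:R * p_s s) = b - p_s s by ring.
by rewrite ler_norml /b; case: percolates => /=; apply/andP; split; lra.
Qed.
End Percolation.

(** * Convergence *)

Lemma Fdist_Phi_bound (R : realType) (s k : nat) (e x : R) (s2 : (2 <= s)%N) :
  let d := inv_sd s R k.+2 in
  0 < e -> d <= 1 ->
  `|Fdist k.+2 s x - Phi x| <= e + d * (15 + 2 * mills_cst + 2 * e^-1).
Proof.
move=> d e0 d1; pose p : R := p_s s.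
have p0 : 0 < p by exact: p_s_gt0.
have p1 : p < 1 by exact: p_s_lt1.
have p01 : 0 < p < 1 by rewrite p0 p1.
have pq0 : 0 < p * (1 - p) by rewrite mulr_gt0// subr_gt0.
have n0 : 0 < k.+2%:R :> R by rewrite ltr0n.
have d0 : 0 < d by rewrite invr_gt0 mulr_gt0// sqrtr_gt0.
have d01 : 0 < d <= 1 by rewrite d0 d1.
have dE : d ^+ 2 * k.+2%:R * (p * (1 - p)) = 1.
  have [r0 q0] : 0 < Num.sqrt k.+2%:R :> R /\ 0 < Num.sqrt (p * (1 - p)) by rewrite !sqrtr_gt0.
  have := sqr_sqrtr (ltW pq0); have := sqr_sqrtr (ltW n0).
  rewrite /d /inv_sd -/p; move: (Num.sqrt _) (Num.sqrt _) r0 q0 => r q r0 q0 <- <-.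
  by field; rewrite !gt_eqF.
pose W (j : nat) : R := (j%:R - k.+1%:R * p) * d.
(* Shifting the ramps by [d] absorbs the contribution of the last fluid. *)
pose F j := ramp (x - d - e) e (W j).
pose G j := ramp (x + d) e (W j).
have FG j z : `|z - W j| <= d -> F j <= (z <= x)%R%:R <= G j.
  rewrite ler_norml => /andP[zl zu].
  have [_ /(_ (W j))/andP[F0 F1]] := ramp_weight (x - d - e) e.
  have [_ /(_ (W j))/andP[G0 G1]] := ramp_weight (x + d) e.
  case: (leP z x) => zx; apply/andP; split=> //.
  - by rewrite /G ramp1//; lra.
  - by rewrite /F ramp0//; lra.
have /andP[lb ub] := Fdist_sandwich s2 FG.
have := binmean_ramp_bound p01 d01 dE (x - d - e) e0.
have := binmean_ramp_bound p01 d01 dE (x + d) e0.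
(* The lower ramp equals 1 up to [x - d - e], so its Gaussian mean is at least [Phi] there. *)
have Fm : Phi (x - d - e) <= gauss_int (ramp (x - d - e) e) (x - d - e + e).
  have := @gauss_int_eq_Phi R (ramp (x - d - e) e) (x - d - e) (fun t => @ramp1 _ _ _ t e0).
  move=> <-; apply: gauss_int_ndecr; first exact: ramp_weight.
  by rewrite lerDl ltW.
have Gm := gauss_int_le_Phi (x + d + e) (ramp_weight (x + d) e).
(* As the density is at most 1, replacing the shifted argument by [x] costs at most the shift; its
   [d] raises 14 to 15. *)
have L1 : Phi x - Phi (x - d - e) <= d + e.
  have := @Phi_increment _ (x - d - e) (d + e) (ltW (addr_gt0 d0 e0)).
  by rewrite [X in Phi X - _](_ : _ = x)//; ring.
have L2 : Phi (x + d + e) - Phi x <= d + e.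
  by have := @Phi_increment _ x (d + e) (ltW (addr_gt0 d0 e0)); rewrite addrA.
rewrite !ler_norml => /andP[_ uG] /andP[lF _].
have -> : d * (15 + 2 * mills_cst + 2 * e^-1) =
  d + d * (14 + 2 * mills_cst + 2 * e^-1) by ring.
move: (d * (14 + _ + _)) uG lF => D uG lF.
by apply/andP; split; rewrite -/p in lb ub; lra.
Qed.

Theorem theorem1 (R : realType) (s : nat) (hs : (2 <= s)%N) :
  forall eps : R, 0 < eps ->
  exists N : nat, forall n : nat, (2 <= n)%N -> (N <= n)%N ->
    forall x : R, `|Fdist n s x - Phi x| < eps.
Proof.
move=> eps eps0.
have pq0 : 0 < p_s s * (1 - p_s s) :> R.
  by rewrite mulr_gt0 ?subr_gt0 ?p_s_gt0 ?p_s_lt1.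
(* The ramp width [eps / 2] uses half of the tolerance, and [K] is the resulting factor of [d] in
   the error. *)
pose K : R := 15 + 2 * mills_cst + 2 * (eps / 2)^-1.
have C0 : 0 < mills_cst :> R by rewrite ltr_pwDl// invr_ge0 ltW// phi_gt0.
have e20 : 0 < eps / 2 by rewrite divr_gt0.
have K0 : 0 < K.
  by have := divr_gt0 (ltr0n R 1) e20; rewrite /K div1r; lra.
(* Once [d * c < 1], both [d < 1] and [d * K < eps / 2] follow. The threshold on [n] below ensures
   this, since [d^-1] is the square root of [n * p_s s * (1 - p_s s)]. *)
pose c : R := 1 + 2 * K / eps.
have c0 : 0 < c by rewrite addr_gt0// divr_gt0// mulr_gt0.
exists (Num.truncn (c ^+ 2 / (p_s s * (1 - p_s s)))).+1 => -[|[|k]]// _ Nn x.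
have dc : c < (inv_sd s R k.+2)^-1.
  rewrite /inv_sd invrK -sqrtrM ?ler0n//.
  rewrite -[X in X < _](ger0_norm (ltW c0)) -sqrtr_sqr ltr_sqrt ?(mulr_gt0 (ltr0Sn _ _) pq0)//.
  rewrite -ltr_pdivrMr//.
  by rewrite (lt_le_trans (truncnS_gt _))// ler_nat.
have d0 : 0 < inv_sd s R k.+2 by rewrite -invr_gt0 (lt_trans c0).
have d1 : inv_sd s R k.+2 * c < 1 by rewrite -ltr_pdivlMl// mulr1.
have dle1 : inv_sd s R k.+2 <= 1.
  by rewrite (le_trans _ (ltW d1))// ler_peMr ?(ltW d0)// lerDl ltW// divr_gt0// mulr_gt0.
apply: le_lt_trans (Fdist_Phi_bound x hs e20 dle1) _.
have : inv_sd s R k.+2 * K < eps / 2.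
  have : inv_sd s R k.+2 * c * eps < eps by rewrite gtr_pMl.
  have -> : inv_sd s R k.+2 * c * eps = inv_sd s R k.+2 * eps + inv_sd s R k.+2 * K * 2.
    by rewrite /c; field; rewrite gt_eqF.
  by have := mulr_gt0 d0 eps0; lra.
by rewrite -/K; lra.
Qed.
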